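(* Let $(W,S)$ be a Coxeter system with $S$ finite, and let $\Gamma$ be the set of gates of the cone type parts $\{Q(T)\mid T\in\mathbb{T}\}$. Then $$\Gamma^0=\{g\in\Gamma\mid|\Phi^R(g)|=1\}$$ is the set of join-irreducible elements of the partially ordered set $(\Gamma,\preceq)$.
   Context: $(W,S)$ is a Coxeter system with $S$ finite and $\ell$ is the word length with respect to $S$. $V$ is the real vector space with basis $\{\alpha_s\mid s\in S\}$ and symmetric bilinear form $\langle\alpha_s,\alpha_t\rangle=-\cos(\pi/m(s,t))$ (equal to $-1$ if $m(s,t)=\infty$); $W$ acts on $V$ by $sv=v-2\langle v,\alpha_s\rangle\alpha_s$. Right weak order: $x\preceq y$ iff $\ell(y)=\ell(x)+\ell(x^{-1}y)$. Right descent set: $D_R(w)=\{s\in S\mid\ell(ws)=\ell(w)-1\}$; right-descent roots: $\Phi^R(w)=\{-w\alpha_s\mid s\in D_R(w)\}$. Cone type of $w$: $T(w)=\{v\in W\mid\ell(wv)=\ell(w)+\ell(v)\}$; $\mathbb{T}=\{T(w)\mid w\in W\}$. For $T\in\mathbb{T}$ the cone type part is $Q(T)=\{x\in W\mid T(x^{-1})=T\}$. It is known that each $Q(T)$ has a unique element $g_T\in Q(T)$ with $g_T\preceq x$ for all $x\in Q(T)$, called the gate of $Q(T)$; $\Gamma=\{g_T\mid T\in\mathbb{T}\}$. It is also known that $\Gamma$ is closed under joins (in the right weak order on $W$) of those subsets that are bounded above in $W$. For a poset $P$, an element $x\in P$ is join-irreducible if $x$ is not the minimal element of $P$ and $x=a\vee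 b$ (with $a,b\in P$) implies $x=a$ or $x=b$; equivalently, if $X\subseteq P$ and $x=\bigvee X$ then $x\in X$. *)

(* Defs.v *)
From HB Require Import structures.
From mathcomp Require Import all_boot all_order all_algebra.
From mathcomp Require Import boolp classical_sets cardinality reals trigo.
From mathcomp Require Import ring.
Set Implicit Arguments.
Unset Strict Implicit.
Unset Printing Implicit Defensive.
Import Order.TTheory GRing.Theory Num.Theory.
Local Open Scope classical_set_scope.
Local Open Scope ring_scope.

(* The congruence on words generated by the Coxeter relations
   [(s t)^(m s t) = 1]. Only positive words are needed: since [m s s = 1] is
   required below, every generator is its own inverse modulo the congruence, so
   the quotient is the group presented by these relations. A pair with
   [m s t = 0] (i.e. infinity) yields the empty relation. *)
Inductive coxeter_equiv (S : Type) (m : S -> S -> nat) : seq S -> seq S -> Prop :=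
| coxeter_rel s t u v :
    coxeter_equiv m (u ++ flatten (nseq (m s t) [:: s; t]) ++ v) (u ++ v)
| coxeter_refl u : coxeter_equiv m u u
| coxeter_sym u v : coxeter_equiv m u v -> coxeter_equiv m v u
| coxeter_trans u v w :
    coxeter_equiv m u v -> coxeter_equiv m v w -> coxeter_equiv m u w.

Definition word_prod (W : groupType) (S : Type) (gen : S -> W) (u : seq S) : W :=
  (\prod_(s <- u) gen s)%g.

(* [S] indexes the simple generators (injectively) and [cox_m s t = 0] encodes
   [m(s,t) = oo]. The last two fields say that [W] is generated by [S] with the
   relations [(s t)^m(s,t) = 1] as a presentation. *)
Record coxeterSystem (W : groupType) (S : finType) := CoxeterSystem {
  gen : S -> W;
  cox_m : S -> S -> nat;
  gen_inj : injective gen;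
  cox_m_sym : forall s t, cox_m s t = cox_m t s;
  cox_m_diag : forall s t, (cox_m s t == 1%N) = (s == t);
  gen_full : forall w, exists u, word_prod gen u = w;
  gen_presentation : forall u v,
    word_prod gen u = word_prod gen v <-> coxeter_equiv cox_m u v }.

Section Length.
Variables (W : groupType) (S : finType) (C : coxeterSystem W S).

Definition has_word_of_size (w : W) : pred nat :=
  fun n => `[< exists2 u : seq S, size u = n & word_prod (gen C) u = w >].

Lemma ex_word_of_size w : exists n, has_word_of_size w n.
Proof.
have [u uw] := gen_full C w.
by exists (size u); apply/asboolP; exists u.
Qed.

Definition len (w : W) : nat := ex_minn (ex_word_of_size w).

Definition weak_le (x y : W) : Prop := len y = (len x + len (x^-1 * y)%g)%N.

(* [(len (w s)).+1 = len w] avoids truncated subtraction. *)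
Definition right_descents (w : W) : set S :=
  [set s | (len (w * gen C s)%g).+1 = len w].

Definition cone_type (w : W) : set W :=
  [set v | len (w * v)%g = (len w + len v)%N].

Definition cone_types : set (set W) := range cone_type.

Definition cone_part (T : set W) : set W := [set x | cone_type x^-1%g = T].

Definition is_gate (T : set W) (g : W) : Prop :=
  cone_part T g /\ forall x, cone_part T x -> weak_le g x.

Definition gates : set W := [set g | exists2 T, cone_types T & is_gate T g].

End Length.

Section Geometric.
Variables (R : realType) (W : groupType) (S : finType) (C : coxeterSystem W S).

Local Notation V := {ffun S -> R^o}.

Definition simple_root (s : S) : V := [ffun t => (t == s)%:R].

Definition gram (s t : S) : R :=
  if cox_m C s t == 0%N then -1 else - cos (pi / (cox_m C s t)%:R).

Definition form (u v : V) : R := \sum_s \sum_t u s * v t * gram s t.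

Definition reflection (s : S) (v : V) : V :=
  v - (2 * form v (simple_root s)) *: simple_root s.

Definition word_act (u : seq S) (v : V) : V := foldr reflection v u.

(* The element [w] acts through an arbitrary word representing it; the lemmas
   [act_gen], [act1] and [actM] below show that this is the action of [W]
   determined by the action of the simple generators. *)
Definition act (w : W) (v : V) : V := word_act (sval (cid (gen_full C w))) v.

Definition right_descent_roots (w : W) : set V :=
  [set - act w (simple_root s) | s in right_descents C w].

Lemma vecDE (u v : V) i : (u + v) i = u i + v i :> R.
Proof. by rewrite ffunE. Qed.

Lemma vecZE a (u : V) i : (a *: u) i = a * u i :> R.
Proof. by rewrite ffunE. Qed.

Lemma simple_rootE s t : simple_root s t = (t == s)%:R :> R.
Proof. by rewrite ffunE. Qed.

Lemma formDl (u v w : V) : form (u + v) w = form u w + form v w.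
Proof.
rewrite /form -big_split; apply: eq_bigr => s _ /=.
by rewrite -big_split; apply: eq_bigr => t _ /=; rewrite vecDE; ring.
Qed.

Lemma formZl a (u w : V) : form (a *: u) w = a * form u w.
Proof.
rewrite /form big_distrr; apply: eq_bigr => s _ /=.
by rewrite big_distrr; apply: eq_bigr => t _ /=; rewrite vecZE; ring.
Qed.

Lemma form_simple s t : form (simple_root s) (simple_root t) = gram s t.
Proof.
rewrite /form (bigD1 s) //= [X in _ + X]big1 ?addr0; last first.
  by move=> i nis; rewrite big1 // => j _; rewrite simple_rootE (negbTE nis) !mul0r.
rewrite (bigD1 t) //= [X in _ + X]big1 ?addr0; last first.
  by move=> i nit; rewrite !simple_rootE (negbTE nit) mulr0 mul0r.
by rewrite !simple_rootE !eqxx !mul1r.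
Qed.

Lemma gram_sym s t : gram s t = gram t s.
Proof. by rewrite /gram cox_m_sym. Qed.

Lemma gram_diag s : gram s s = 1.
Proof.
rewrite /gram; have /eqP -> : cox_m C s s == 1%N by rewrite cox_m_diag.
by rewrite /= divr1 cospi opprK.
Qed.

Lemma reflectionK s : involutive (reflection s).
Proof.
move=> v; rewrite /reflection -!scaleNr formDl formZl form_simple gram_diag.
by apply/ffunP => i; rewrite !(vecDE, vecZE, simple_rootE); ring.
Qed.

(* In the plane spanned by two simple roots at angle [pi - x], the product of
   the two reflections is the rotation by [2 x]. *)
Lemma reflection2_iter s t x a b (v : V) k : sin x != 0 ->
    gram s t = - cos x ->
    form v (simple_root s) = a - cos x * b ->
    form v (simple_root t) = b - cos x * a ->
  let sk := sin (x *+ 2 *+ k) in let ck := cos (x *+ 2 *+ k) in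
  iter k (fun v => reflection s (reflection t v)) v =
  v + (ck * a + (cos x * a - b) * sk / sin x - a) *: simple_root s
    + (ck * b + (a - cos x * b) * sk / sin x - b) *: simple_root t.
Proof.
move=> sx0 gst fs ft /=.
have gts : gram t s = - cos x by rewrite gram_sym.
elim: k => [|k IH] /=.
  rewrite !mulr0n sin0 cos0; apply/ffunP => i.
  by rewrite !(vecDE, vecZE, simple_rootE); ring.
have -> : cos (x *+ 2 *+ k.+1) =
    cos (x *+ 2 *+ k) * (1 - 2 * sin x ^+ 2)
    - sin (x *+ 2 *+ k) * (2 * cos x * sin x).
  by rewrite mulrSr cosD sin_mulr2n [cos (x *+ 2)]cosD -!expr2 sin2cos2; ring.
have -> : sin (x *+ 2 *+ k.+1) =
    sin (x *+ 2 *+ k) * (1 - 2 * sin x ^+ 2)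
    + cos (x *+ 2 *+ k) * (2 * cos x * sin x).
  by rewrite mulrSr sinD sin_mulr2n [cos (x *+ 2)]cosD -!expr2 sin2cos2; ring.
rewrite IH; move: (sin (x *+ 2 *+ k)) (cos (x *+ 2 *+ k)) => sk ck {IH}.
rewrite /reflection -!scaleNr !(formDl, formZl, form_simple) !gram_diag gst gts.
rewrite fs ft; apply/ffunP => i; rewrite !(vecDE, vecZE, simple_rootE).
have c2 := cos2Dsin2 x.
move: (sin x) (cos x) (v i) (_ == s)%:R (_ == t)%:R sx0 c2 => z c w p q z0 c2.
have c2' : c ^+ 2 = 1 - z ^+ 2 by rewrite -c2; ring.
by field: c2'.
Qed.

Lemma reflection2_order s t v :
  iter (cox_m C s t) (fun v => reflection s (reflection t v)) v = v.
Proof.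
have [->|nst] := eqVneq s t.
  have /eqP -> : cox_m C t t == 1%N by rewrite cox_m_diag.
  exact: reflectionK.
have := cox_m_diag C s t; rewrite (negbTE nst).
case m_eq : (cox_m C s t) => [//|[//|n]] _.
set m := n.+2; set x : R := pi / m%:R.
have m_gt0 : 0 < m%:R :> R by rewrite ltr0n.
have sx0 : sin x != 0.
  rewrite gt_eqF // sin_gt0_pi // /x divr_gt0 ?pi_gt0 //=.
  by rewrite ltr_pdivrMr // ltr_pMr ?pi_gt0 // ltr1n.
have gst : gram s t = - cos x by rewrite /gram m_eq.
pose fs := form v (simple_root s); pose ft := form v (simple_root t).
have c2 : cos x ^+ 2 = 1 - sin x ^+ 2 by rewrite sin2cos2; ring.
rewrite (@reflection2_iter s t x ((fs + cos x * ft) / sin x ^+ 2)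
           ((ft + cos x * fs) / sin x ^+ 2)) //; first last.
- by rewrite -/ft; field: c2.
- by rewrite -/fs; field: c2.
have -> : x *+ 2 *+ m = pi *+ 2.
  by rewrite mulrnAC -[x *+ m]mulr_natr /x divfK // gt_eqF.
have -> : cos (pi *+ 2) = 1 :> R by rewrite -[_ *+ _]add0r cosD2pi cos0.
by rewrite sin2pi; apply/ffunP => i; rewrite !(vecDE, vecZE, simple_rootE); ring.
Qed.

Lemma word_act_cat u u' v : word_act (u ++ u') v = word_act u (word_act u' v).
Proof. by rewrite /word_act foldr_cat. Qed.

Lemma word_act_equiv u u' : coxeter_equiv (cox_m C) u u' ->
  word_act u =1 word_act u'.
Proof.
elim=> {u u'} [s t u u' v|//|u u' _ IH v|u1 u2 u3 _ IH1 _ IH2 v]; last first.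
- by rewrite IH1 IH2.
- by rewrite IH.
rewrite !word_act_cat; congr word_act.
rewrite -[RHS](reflection2_order s t).
by elim: (cox_m C s t) => //= n ->.
Qed.

Lemma act_word_prod u v : act (word_prod (gen C) u) v = word_act u v.
Proof.
rewrite /act; case: cid => u' /= eq_u'; apply: word_act_equiv.
exact/gen_presentation.
Qed.

Lemma act_gen s v : act (gen C s) v = reflection s v.
Proof.
have <- : word_prod (gen C) [:: s] = gen C s by rewrite /word_prod big_seq1.
exact: act_word_prod.
Qed.

Lemma act1 v : act 1%g v = v.
Proof.
have <- : word_prod (gen C) [::] = 1%g by rewrite /word_prod big_nil.
exact: act_word_prod.
Qed.

Lemma actM x y v : act (x * y)%g v = act x (act y v).
Proof.
have [[u <-] [u' <-]] := (gen_full C x, gen_full C y).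
by rewrite /word_prod -big_cat !act_word_prod word_act_cat.
Qed.

End Geometric.

Arguments right_descent_roots R {W S} C w.

Section JoinIrreducible.
Variables (T : Type) (le : T -> T -> Prop) (P : set T).

Definition is_minimum (x : T) : Prop := P x /\ forall y, P y -> le x y.

(* The join is taken inside [P]: [x] is the least upper bound of [a] and [b]
   among the elements of [P]. *)
Definition is_join (a b x : T) : Prop :=
  [/\ P x, le a x, le b x & forall z, P z -> le a z -> le b z -> le x z].

Definition join_irreducible (x : T) : Prop :=
  [/\ P x, ~ is_minimum x &
      forall a b, P a -> P b -> is_join a b x -> x = a \/ x = b].

End JoinIrreducible.

(* Main.v *)
(* A gate [g] is the least upper bound, in the right weak order, of elements
   [h_(v,t)]: for [v] in a cone type [T] and [v t] outside [T], [h_(v,t)] is the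
   least [x] such that [v] but not [v t] belongs to the cone type of [x^-1].
   This gives the existence of gates. Suppose that [h = h_(v,t)] lies below [z];
   that it lies below the gate of [z] is shown by induction on the length of
   [v = r v']. If [r] is not a left descent of [z], cancel it. Otherwise [r \/ h]
   lies below [z], and the crucial fact is that [r \/ h] is a join of elements
   [h_(w,s)] with [w] shorter than [v]. Hence a gate below [z] is below the gate
   of [z]. All this only uses the exchange condition.

   If [g] has a single right descent [s], then gates other than [g] below [g]
   are below the gate of [g s], so [g] is not a join of two of them. If [g] has
   two right descents [r] and [s], then [g] is the join of the gates of [g r] and
   [g s]. *)
Require Import Defs.
From mathcomp Require Import all_boot all_order all_algebra.
From mathcomp Require Import boolp classical_sets cardinality reals.
From mathcomp Require Import zify.
Set Implicit Arguments.
Unset Strict Implicit.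
Unset Printing Implicit Defensive.
Local Open Scope classical_set_scope.
Local Open Scope card_scope.

Lemma cat_eq_cat_cons (T : Type) (p q a b : seq T) y :
  p ++ q = a ++ y :: b ->
  (exists2 c, p = a ++ y :: c & b = c ++ q) \/
  (exists2 c, a = p ++ c & q = c ++ y :: b).
Proof.
elim: p a => [|z p IH] [|w a] /= => [->|->|[-> <-]|[-> /IH]].
- by right; exists [::].
- by right; exists (w :: a).
- by left; exists p.
- by case=> [[c -> ->]|[c -> ->]]; [left|right]; exists c.
Qed.

(** * Reflections attached to the letters of a word *)

Section WordReflections.
Variables (W : groupType) (S : finType) (C : coxeterSystem W S).
Local Open Scope group_scope.
Local Notation r_ := (gen C).

Lemma word_prod_cat u v :
  word_prod r_ (u ++ v) = word_prod r_ u * word_prod r_ v.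
Proof. by rewrite /word_prod big_cat. Qed.

Lemma word_prod_cons s u : word_prod r_ (s :: u) = r_ s * word_prod r_ u.
Proof. by rewrite /word_prod big_cons. Qed.

Lemma word_prod_nil : word_prod r_ [::] = 1.
Proof. by rewrite /word_prod big_nil. Qed.

Lemma word_prod_relator s t :
  word_prod r_ (flatten (nseq (cox_m C s t) [:: s; t])) = 1.
Proof.
rewrite -word_prod_nil; apply/gen_presentation.
by have := coxeter_rel (cox_m C) s t [::] [::]; rewrite cats0.
Qed.

Lemma word_prod_alternating s t k :
  word_prod r_ (flatten (nseq k [:: s; t])) = (r_ s * r_ t) ^+ k.
Proof.
elim: k => [|k IH]; first by rewrite word_prod_nil.
by rewrite /= !word_prod_cons IH mulgA expgS.
Qed.

Lemma gen_sq s : r_ s * r_ s = 1.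
Proof.
have := word_prod_relator s s.
have /eqP -> : cox_m C s s == 1%N by rewrite cox_m_diag.
by rewrite /= !word_prod_cons word_prod_nil mulg1.
Qed.

Lemma genV s : (r_ s)^-1 = r_ s.
Proof. by rewrite -[LHS]mulg1 -(gen_sq s) mulKg. Qed.

Lemma genK s x : r_ s * (r_ s * x) = x.
Proof. by rewrite mulgA gen_sq mul1g. Qed.

Lemma mulgenK s x : x * r_ s * r_ s = x.
Proof. by rewrite -mulgA gen_sq mulg1. Qed.

(* The parity of the number of occurrences of [t] among the reflections
   [s1..s(i-1) si s(i-1)..s1] attached to the letters of a word [s1..sk]. *)
Fixpoint refl_parity (u : seq S) (t : W) : bool :=
  if u is s :: u' then (t == r_ s) (+) refl_parity u' (r_ s * t * r_ s)
  else false.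

Lemma refl_parity_cat u v t :
  refl_parity (u ++ v) t =
  refl_parity u t
  (+) refl_parity v ((word_prod r_ u)^-1 * t * word_prod r_ u).
Proof.
elim: u t => [|s u IH] t /=; first by rewrite word_prod_nil invg1 mul1g mulg1.
by rewrite IH addbA word_prod_cons invgM genV !mulgA.
Qed.

(** The reflection attached to the letter of index [i], counted from 0, in the word [s t s t ...] is
    [(s t)^i s]. *)
Lemma refl_parity_alternating s t k x :
  refl_parity (flatten (nseq k [:: s; t])) x =
  odd (\sum_(i < k.*2) (x == (r_ s * r_ t) ^+ i * r_ s)%g).
Proof.
elim: k x => [|k IH] x; first by rewrite big_ord0.
rewrite doubleS !big_ord_recl /= IH expg0 mul1g expg1 !oddD !oddb.
congr (_ (+) (_ (+) odd _)).
  apply/eqP/eqP => [<-|->]; first by rewrite !mulgA gen_sq mul1g mulgenK.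
  by rewrite !mulgA gen_sq mul1g mulgenK.
apply: eq_bigr => i _; congr nat_of_bool.
rewrite /bump /= !add1n.
have -> : (r_ s * r_ t) ^+ i.+2 * r_ s =
  r_ s * r_ t * ((r_ s * r_ t) ^+ i * r_ s) * (r_ t * r_ s).
  by rewrite expgS expgSr !mulgA.
apply/eqP/eqP => [<-|->].
  by rewrite !mulgA !mulgenK -!mulgA !genK.
by rewrite !mulgA !mulgenK -!mulgA !genK.
Qed.

(** With [m = m(s,t)], the relation [(s t)^m = 1] makes the last [m] reflections repeat the first
    [m], so each occurs an even number of times. *)
Lemma refl_parity_relator s t x :
  refl_parity (flatten (nseq (cox_m C s t) [:: s; t])) x = false.
Proof.
rewrite refl_parity_alternating -addnn big_split_ord /= oddD.
have st1 : (r_ s * r_ t) ^+ cox_m C s t = 1.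
  by rewrite -word_prod_alternating word_prod_relator.
under [X in _ (+) odd X]eq_bigr do rewrite expgnDr st1 mul1g.
by rewrite addbb.
Qed.

(** This makes the parity an invariant of the group element, so that it can be computed in a reduced
    word. *)
Lemma refl_parity_equiv u v :
  coxeter_equiv (cox_m C) u v -> refl_parity u =1 refl_parity v.
Proof.
elim=> {u v} [s t u v x|//|u v _ IH x|u v w _ IH1 _ IH2 x].
- rewrite !refl_parity_cat refl_parity_relator word_prod_relator.
  by rewrite invg1 mul1g mulg1.
- by rewrite IH.
- by rewrite IH1.
Qed.

Lemma odd_size_equiv u v :
  coxeter_equiv (cox_m C) u v -> odd (size u) = odd (size v).
Proof.
elim=> {u v} [s t u v|//|u v _ -> //|u v w _ -> _ -> //].
rewrite !size_cat !oddD; congr (_ (+) _).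
suff -> : odd (size (flatten (nseq (cox_m C s t) [:: s; t]))) = false by [].
by elim: (cox_m C s t) => //= k ->.
Qed.

(** An odd count means that the reflection is attached to some letter; multiplying by it on the left
    deletes that letter. *)
Lemma refl_parity_delete u s : refl_parity u (r_ s) ->
  exists u1 x u2, u = u1 ++ x :: u2 /\
    r_ s * word_prod r_ u = word_prod r_ (u1 ++ u2).
Proof.
(* The induction needs an arbitrary [t], which is conjugated by each letter passed. *)
suff H t : refl_parity u t -> exists u1 x u2, u = u1 ++ x :: u2 /\
    t * word_prod r_ u = word_prod r_ (u1 ++ u2) by exact: H.
elim: u t => [//|x u IH] t /=.
have [-> _|_ /= /IH [u1 [y [u2 [-> e]]]]] := eqVneq t (r_ x).
  by exists [::], x, u; rewrite word_prod_cons genK.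
exists (x :: u1), y, u2; split=> //.
by rewrite /= !word_prod_cons -e -!mulgA genK.
Qed.

End WordReflections.

(** * Length and the exchange condition *)

Section Exchange.
Variables (W : groupType) (S : finType) (C : coxeterSystem W S).
Local Open Scope group_scope.
Local Notation r_ := (gen C).
Local Notation len := (len C).
Local Notation le := (weak_le C).
Implicit Types (x y z w : W) (s t r : S).

Lemma len_word u : len (word_prod r_ u) <= size u.
Proof.
rewrite /Defs.len; case: ex_minnP => n _; apply.
by apply/asboolP; exists u.
Qed.

Lemma len_reduced w : exists2 u, size u = len w & word_prod r_ u = w.
Proof. by rewrite /Defs.len; case: ex_minnP => n /asboolP. Qed.

Lemma len1 : len 1 = 0.
Proof.
by have := len_word [::]; rewrite word_prod_nil leqn0 => /eqP.
Qed.

Lemma len_eq0 w : len w = 0 -> w = 1.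
Proof.
by have [[|s u] /= <- <-] := len_reduced w; rewrite ?word_prod_nil.
Qed.

Lemma lenM x y : len (x * y) <= len x + len y.
Proof.
have [[u <- <-] [v <- <-]] := (len_reduced x, len_reduced y).
by rewrite -word_prod_cat -size_cat len_word.
Qed.

Lemma lenV x : len x^-1 = len x.
Proof.
suff H y : len y^-1 <= len y.
  by apply/eqP; rewrite eqn_leq H -{1}[x]invgK H.
have [u <- <-] := len_reduced y.
suff -> : (word_prod r_ u)^-1 = word_prod r_ (rev u).
  by rewrite -(size_rev u) len_word.
elim: u => [|s u IH]; first by rewrite word_prod_nil invg1.
rewrite word_prod_cons invgM IH rev_cons -cats1 word_prod_cat.
by rewrite word_prod_cons word_prod_nil mulg1 genV.
Qed.

Lemma odd_len_word u : odd (len (word_prod r_ u)) = odd (size u).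
Proof.
have [v <- /gen_presentation] := len_reduced (word_prod r_ u).
exact: odd_size_equiv.
Qed.

Lemma len_gen s : len (r_ s) = 1%N.
Proof.
have := len_word [:: s]; have := odd_len_word [:: s].
by rewrite word_prod_cons word_prod_nil mulg1 /=; lia.
Qed.

(** The triangle inequality bounds the change of length by 1, and parity excludes equality. *)
Lemma len_genM s w : len (r_ s * w) = (len w).+1 \/ (len (r_ s * w)).+1 = len w.
Proof.
have := lenM (r_ s) w; have := lenM (r_ s) (r_ s * w); rewrite genK len_gen.
suff : odd (len (r_ s * w)) != odd (len w) by lia.
have [u <-] := gen_full C w.
by rewrite -word_prod_cons !odd_len_word /=; case: odd.
Qed.

Lemma exchange s x u : len x < len (r_ s * x) ->
    len (r_ s * (x * u)) < len (x * u) ->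
  exists2 u', r_ s * (x * u) = x * u' & len u' < len u.
Proof.
move=> sx sxu.
have [[p px ex] [q qu eu]] := (len_reduced x, len_reduced u).
(* Otherwise the count of [s] is odd in a reduced word of [s x u], and deleting a letter there gives
   a word too short for [x u]. *)
have par : refl_parity C (p ++ q) (r_ s).
  apply/negPn/negP => npar.
  have [v vl ev] := len_reduced (r_ s * (x * u)).
  have : refl_parity C v (r_ s).
    have -> : refl_parity C v (r_ s) = refl_parity C (s :: p ++ q) (r_ s).
      apply: refl_parity_equiv; apply/gen_presentation.
      by rewrite ev word_prod_cons word_prod_cat ex eu.
    by rewrite /= eqxx gen_sq mul1g (negbTE npar).
  move=> /refl_parity_delete [v1 [y [v2 [ev12]]]].
  rewrite ev genK => e; have := len_word (v1 ++ v2).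
  by move: vl sxu; rewrite -e ev12 !size_cat /=; lia.
have [u1 [y [u2 [epq]]]] := refl_parity_delete par.
rewrite word_prod_cat ex eu => e.
(* The deleted letter lies in [q]: deleting one of [p] would make [s x] shorter than [x]. *)
have [[u3 ep eu2]|[u3 eu1 eq]] := cat_eq_cat_cons epq.
  have e' : r_ s * x = word_prod r_ (u1 ++ u3).
    by apply: (mulIg u); rewrite -mulgA e eu2 catA word_prod_cat eu.
  have := len_word (u1 ++ u3); rewrite -e'.
  by move: sx; rewrite -px ep !size_cat /=; lia.
exists (word_prod r_ (u3 ++ u2)); first by rewrite e eu1 -catA word_prod_cat ex.
by have := len_word (u3 ++ u2); rewrite -qu eq !size_cat /=; lia.
Qed.

End Exchange.

(** * The right weak order *)

(* The group operations reach [W] through several convertible structure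
   projections, which [lia] would treat as distinct atoms; [set] identifies
   them. *)
Ltac group_lia :=
  repeat match goal with H : context [Defs.len _ _] |- _ => revert H end;
  repeat match goal with
    |- context [Defs.len ?C ?a] =>
      let n := fresh "n" in set n := (Defs.len C a); clearbody n
  end; lia.

Section WeakOrder.
Variables (W : groupType) (S : finType) (C : coxeterSystem W S).
Local Open Scope group_scope.
Local Notation r_ := (gen C).
Local Notation len := (len C).
Local Notation le := (weak_le C).
Implicit Types (x y z w v : W) (s t r : S).

Definition ldesc s w : bool := len (r_ s * w) < len w.

(* [compat v x] says that [v] lies in the cone type of [x^-1]. *)
Definition compat v x : Prop := len (v^-1 * x) = (len v + len x)%N.

Lemma ldescE s w : ldesc s w -> (len (r_ s * w)).+1 = len w.
Proof. by rewrite /ldesc; have := len_genM C s w; group_lia. Qed.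

Lemma ldescN s w : ~~ ldesc s w -> len (r_ s * w) = (len w).+1.
Proof. by rewrite /ldesc; have := len_genM C s w; group_lia. Qed.

Lemma ldesc_mul s w : ldesc s (r_ s * w) = ~~ ldesc s w.
Proof. by rewrite /ldesc genK; have := len_genM C s w; group_lia. Qed.

Lemma ex_ldesc w : w <> 1 -> exists s, ldesc s w.
Proof.
have [[|s u] su ew] := len_reduced C w; first by case; rewrite -ew word_prod_nil.
by exists s; rewrite /ldesc -su -ew word_prod_cons genK ltnS len_word.
Qed.

Lemma compatC v x : compat v x <-> compat x v.
Proof.
rewrite /compat; have -> : len (v^-1 * x) = len (x^-1 * v).
  by rewrite -lenV invgM invgK.
by rewrite addnC.
Qed.

Lemma compat_gen s x : compat (r_ s) x <-> ~~ ldesc s x.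
Proof.
rewrite /compat genV len_gen /ldesc; have := len_genM C s x.
by split; group_lia.
Qed.

Lemma compatM v w x : len (v * w) = (len v + len w)%N ->
  compat (v * w) x <-> compat v x /\ compat w (v^-1 * x).
Proof.
rewrite /compat invgM -mulgA => ->.
have := lenM C v^-1 x; have := lenM C w^-1 (v^-1 * x); rewrite !lenV.
by split=> [|[]]; group_lia.
Qed.

Lemma le_len x y : le x y -> len x <= len y.
Proof. by rewrite /weak_le => ->; rewrite leq_addr. Qed.

Lemma le_refl x : le x x.
Proof. by rewrite /weak_le mulVg len1 addn0. Qed.

Lemma le1 x : le 1 x.
Proof. by rewrite /weak_le invg1 mul1g len1. Qed.

Lemma le_len_eq x y : le x y -> len y <= len x -> x = y.
Proof.
rewrite /weak_le => e l; have /len_eq0 : len (x^-1 * y) = 0 by group_lia.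
by move=> e1; rewrite -[y](mulVKg x) e1 mulg1.
Qed.

Lemma le_antisym x y : le x y -> le y x -> x = y.
Proof. by move=> xy /le_len; exact: le_len_eq. Qed.

Lemma le_trans x y z : le x y -> le y z -> le x z.
Proof.
rewrite /weak_le => xy yz.
have := lenM C x (x^-1 * z); have := lenM C (x^-1 * y) (y^-1 * z).
by rewrite mulVKg -!mulgA mulVKg; group_lia.
Qed.

Lemma compat_le v x y : le x y -> compat v y -> compat v x.
Proof.
rewrite /weak_le /compat => xy vy.
have := lenM C v^-1 x; have := lenM C (v^-1 * x) (x^-1 * y).
by rewrite -mulgA mulVKg lenV; group_lia.
Qed.

Lemma le_compat v x y : compat v x -> compat v y ->
  le (v^-1 * x) (v^-1 * y) <-> le x y.
Proof.
rewrite /compat /weak_le invgM invgK -mulgA mulVKg => -> ->.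
by split; group_lia.
Qed.

Lemma compat_leV v x : compat v x <-> le v^-1 (v^-1 * x).
Proof. by rewrite /compat /weak_le invgK mulVKg lenV. Qed.

Lemma le_gen s x : le (r_ s) x <-> ldesc s x.
Proof.
rewrite /weak_le genV len_gen /ldesc; have := len_genM C s x.
by split; group_lia.
Qed.

Lemma ldesc_le s x y : le x y -> ldesc s x -> ldesc s y.
Proof. by move=> xy /le_gen sx; apply/le_gen; apply: le_trans xy. Qed.

Lemma le_genM s x y : ldesc s x = ldesc s y ->
  le (r_ s * x) (r_ s * y) <-> le x y.
Proof.
have [sx /esym sy|sx /esym/negbT sy] := boolP (ldesc s x); last first.
  have := @le_compat (r_ s) x y; rewrite genV; apply; exact/compat_gen.
have := @le_compat (r_ s) (r_ s * x) (r_ s * y); rewrite genV !genK.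
by move=> H; rewrite H //; apply/compat_gen; rewrite ldesc_mul ?sx ?sy.
Qed.

(** Exchange applied to [z = x (x^-1 z)] shortens the second factor: [s z = x u], hence
    [z = (s x) u]. *)
Lemma le_genMl s x z : ldesc s z -> ~~ ldesc s x -> le x z -> le (r_ s * x) z.
Proof.
rewrite /weak_le => sz sx xz.
have [||u e ul] := @exchange _ _ C s x (x^-1 * z).
- by rewrite ldescN.
- by rewrite mulVKg.
rewrite mulVKg in e.
have eu : u = (r_ s * x)^-1 * z by rewrite invgM genV -mulgA e mulKg.
have := lenM C (r_ s * x) u; rewrite {1}eu mulVKg -eu.
by have := ldescN sx; group_lia.
Qed.

Lemma le_genMr s x z : ldesc s z -> ~~ ldesc s x -> le x z -> le x (r_ s * z).
Proof.
move=> sz sx xz; rewrite -(@le_genM s) ?ldesc_mul ?sz ?(negbTE sx) // genK.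
exact: le_genMl.
Qed.

Lemma le_genMlr s x z : ~~ ldesc s z -> le x z -> le (r_ s * x) (r_ s * z).
Proof.
move=> sz xz; apply/le_genM => //; rewrite (negbTE sz); apply/negbTE.
by apply: contra sz; exact: ldesc_le.
Qed.

(** Exchange can only delete the letter [t], so [s w t = w]. *)
Lemma ldesc_new s t w : ~~ ldesc s w -> ldesc s (w * r_ t) ->
  r_ s * w = w * r_ t.
Proof.
move=> sw swt; have [|u e] := @exchange _ _ C s w (r_ t) _ swt.
  by rewrite ldescN.
rewrite len_gen ltnS leqn0 => /eqP/len_eq0 u1.
by move: e; rewrite u1 mulg1 mulgA => e; rewrite -{2}e mulgenK.
Qed.

Lemma lt_right_descent x y : le x y -> x <> y ->
  exists2 s, (len (y * r_ s)).+1 = len y & le x (y * r_ s).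
Proof.
rewrite /weak_le => xy nxy; have [u su eu] := len_reduced C (x^-1 * y).
case/lastP: u su eu => [|u s] su eu.
  by case: nxy; rewrite -[y](mulVKg x) -eu word_prod_nil mulg1.
have e : x^-1 * (y * r_ s) = word_prod r_ u.
  by rewrite mulgA -eu -cats1 word_prod_cat word_prod_cons word_prod_nil mulg1 mulgenK.
rewrite size_rcons in su.
have := len_word C u; rewrite -e => l.
have := lenM C (y * r_ s) (r_ s); rewrite mulgenK len_gen => l1.
have := lenM C x (x^-1 * (y * r_ s)); rewrite mulVKg => l2.
by exists s; rewrite /weak_le; group_lia.
Qed.

(** * Bounded joins *)

Definition is_lub (X : set W) j : Prop :=
  (forall x, X x -> le x j) /\ forall y, (forall x, X x -> le x y) -> le j y.

Definition joins x y j : Prop :=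
  [/\ le x j, le y j & forall z, le x z -> le y z -> le j z].

(* Starting from [s], multiply on the left by [t] and [s] in turn until both are
   left descents: by [le_genMl] this stays below [z] and [z']. *)
Lemma common_ldesc s t z z' : ldesc s z -> ldesc s z' -> ldesc t z ->
  ldesc t z' -> exists c, [/\ ldesc s c, ldesc t c, le c z & le c z'].
Proof.
move=> sz sz' tz tz'.
suff H n s' t' x : ldesc s' z -> ldesc s' z' -> ldesc t' z -> ldesc t' z' ->
    len z - len x <= n -> ldesc s' x -> le x z -> le x z' ->
    exists c, [/\ ldesc s' c, ldesc t' c, le c z & le c z'].
  by apply: (H (len z - len (r_ s)) s t (r_ s)) => //; apply/le_gen => //;
    apply: le_refl.
elim: n s' t' x => [|n IH] s' t' x sz1 sz1' tz1 tz1' l sx xz xz'.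
  have ez : x = z by apply: le_len_eq => //; group_lia.
  by exists z; split=> //; [exact: le_refl|rewrite -{1}ez].
have [tx|tx] := boolP (ldesc t' x); first by exists x.
have [c [tc sc cz cz']] :
    exists c, [/\ ldesc t' c, ldesc s' c, le c z & le c z'].
  apply: (IH t' s' (r_ t' * x)) => //.
  - by have := le_len (le_genMl tz1 tx xz); have := ldescN tx; group_lia.
  - by rewrite ldesc_mul.
  - exact: le_genMl.
  - exact: le_genMl.
by exists c.
Qed.

(** Induction on the length of [z]. Two elements with a common left descent are handled by
    cancelling it; [common_ldesc] gives an element sharing a left descent with [a] and one with
    [b]. *)
Lemma weak_directed a b z z' : le a z -> le b z -> le a z' -> le b z' ->
  exists c, [/\ le a c, le b c, le c z & le c z'].
Proof.
move: {2}(len z) (leqnn (len z)) => n.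
elim: n a b z z' => [|n IH] a b z z' l az bz az' bz'.
  have z1 : z = 1 by apply: (@len_eq0 _ _ C); group_lia.
  have a1 u : le u z -> u = 1.
    by move=> uz; rewrite -z1; apply: le_len_eq => //; rewrite z1 len1.
  by exists 1; rewrite (a1 a) // (a1 b) //; split; apply: le1.
have step s c d : ldesc s c -> ldesc s d -> le c z -> le c z' -> le d z ->
    le d z' -> exists e, [/\ le c e, le d e, le e z & le e z'].
  move=> sc sd cz cz' dz dz'.
  have [sz sz'] := (ldesc_le cz sc, ldesc_le cz' sc).
  have [||||| e [ce de ez ez']] :=
      IH (r_ s * c) (r_ s * d) (r_ s * z) (r_ s * z').
  - by have := ldescE sz; group_lia.
  - by apply/le_genM; rewrite // sz.
  - by apply/le_genM; rewrite // sz.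
  - by apply/le_genM; rewrite // sz'.
  - by apply/le_genM; rewrite // sz'.
  have se : ~~ ldesc s e.
    by apply/negP => /(ldesc_le ez); rewrite ldesc_mul sz.
  exists (r_ s * e); split.
  - by rewrite -[c](genK C s); apply: le_genMlr.
  - by rewrite -[d](genK C s); apply: le_genMlr.
  - by rewrite -[z](genK C s); apply: le_genMlr => //; rewrite ldesc_mul sz.
  - by rewrite -[z'](genK C s); apply: le_genMlr => //; rewrite ldesc_mul sz'.
have [->|/eqP a1] := eqVneq a 1.
  by exists b; split=> //; [exact: le1|exact: le_refl].
have [->|/eqP b1] := eqVneq b 1.
  by exists a; split=> //; [exact: le_refl|exact: le1].
have [s sa] := ex_ldesc a1; have [t tb] := ex_ldesc b1.
have [c [sc tc cz cz']] : exists c, [/\ ldesc s c, ldesc t c, le c z & le c z'].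
  apply: common_ldesc; [exact: ldesc_le sa|exact: ldesc_le sa| |];
    exact: ldesc_le tb.
have [d [cd ad dz dz']] := step s c a sc sa cz cz' az az'.
have [e [de be ez ez']] := step t d b (ldesc_le cd tc) tb dz dz' bz bz'.
by exists e; split=> //; apply: le_trans de.
Qed.

(** Let [j] be a shortest upper bound below [z]. For any upper bound [y], a longest common lower
    bound [c] of [j] and [y] is an upper bound of [X] by [weak_directed], so [c = j]. *)
Lemma ex_lub (X : set W) z : (forall x, X x -> le x z) ->
  exists2 j, is_lub X j & le j z.
Proof.
move=> Xz; pose ub y := forall x, X x -> le x y.
have ex_ub : exists m, `[< exists j, [/\ ub j, le j z & len j = m] >].
  by exists (len z); apply/asboolP; exists z; split=> //; exact: le_refl.
case: (ex_minnP ex_ub) => m /asboolP [j [jub jz lj]] m_min.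
exists j => //; split=> // y yub.
pose low c := le c j /\ le c y.
have ex_low : exists n, `[< exists2 c, low c & len c = n >].
  by exists 0; apply/asboolP; exists 1; [split; exact: le1|rewrite len1].
have low_le n : `[< exists2 c, low c & len c = n >] -> n <= len j.
  by move=> /asboolP [c [cj _] <-]; exact: le_len.
case: (ex_maxnP ex_low low_le) => n /asboolP [c [cj cy] lc] n_max.
have cub : ub c.
  move=> x Xx; have [e [ce xe ej ey]] := weak_directed cj (jub x Xx) cy (yub x Xx).
  rewrite (le_len_eq ce) // lc; apply: n_max; apply/asboolP; exists e => //.
suff -> : j = c by [].
apply/esym; apply: le_len_eq => //; rewrite lj; apply: m_min; apply/asboolP.
by exists c; split=> //; apply: le_trans jz.
Qed.

Lemma ex_joins x y z : le x z -> le y z -> exists2 j, joins x y j & le j z.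
Proof.
move=> xz yz; have [|j [jub jle] jz] := @ex_lub [set x; y] z.
  by move=> _ [->|->].
exists j => //; split; [by apply: jub; left|by apply: jub; right|].
by move=> u xu yu; apply: jle => _ [->|->].
Qed.

Lemma joins_uniq x y j j' : joins x y j -> joins x y j' -> j = j'.
Proof.
move=> [xj yj jle] [xj' yj' j'le].
by apply: le_antisym; [exact: jle|exact: j'le].
Qed.

Lemma compat1 x : compat 1 x.
Proof. by rewrite /compat invg1 mul1g len1. Qed.

Lemma last_letter v : v <> 1 ->
  exists v' t, v = v' * r_ t /\ len v = (len v').+1.
Proof.
move=> v1; have [|s sv _] := @lt_right_descent 1 v (le1 v); first exact/nesym.
by exists (v * r_ s), s; rewrite mulgenK.
Qed.

Lemma compat_last v t x : len (v * r_ t) = (len v).+1 ->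
  compat (v * r_ t) x <-> compat v x /\ ~~ ldesc t (v^-1 * x).
Proof.
by move=> l; rewrite compatM ?len_gen ?addn1 // compat_gen.
Qed.

Lemma ldescV t v : ldesc t v^-1 = (len (v * r_ t) < len v).
Proof.
rewrite /ldesc lenV; have -> // : len (r_ t * v^-1) = len (v * r_ t).
by rewrite -lenV invgM invgK genV.
Qed.

(** Induction on [v = v' t]: if [t] were a left descent of [v'^-1 j], then [v' t v'^-1 j] would be
    an upper bound of [a] and [b] shorter than [j]. *)
Lemma compat_joins v a b j : joins a b j -> compat v a -> compat v b ->
  compat v j.
Proof.
move=> [aj bj jle]; have [n] := ubnP (len v).
elim: n v => // n IH v ln va vb.
have [->|/eqP v1] := eqVneq v 1; first exact: compat1.
have [v' [t [ev lv]]] := last_letter v1; rewrite {v v1}ev in lv va vb ln *.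
have [v'a ta] := (compat_last a lv).1 va.
have [v'b tb] := (compat_last b lv).1 vb.
have v'j : compat v' j by apply: IH => //; group_lia.
apply/compat_last => //; split=> //; apply/negP => tj.
have tv' : ~~ ldesc t v'^-1 by rewrite ldescV; group_lia.
pose j' := v' * (r_ t * (v'^-1 * j)).
have ej' : v'^-1 * j' = r_ t * (v'^-1 * j) by rewrite mulKg.
have v'j' : compat v' j'.
  by apply/compat_leV; rewrite ej'; apply: le_genMr => //; apply/compat_leV.
have le_j' u : le u j -> compat v' u -> ~~ ldesc t (v'^-1 * u) -> le u j'.
  move=> uj v'u tu; apply/(le_compat v'u v'j'); rewrite ej'.
  by apply: le_genMr => //; apply/le_compat.
have /(le_compat v'j v'j') := jle j' (le_j' a aj v'a ta) (le_j' b bj v'b tb).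
by rewrite ej' => /le_len; have := ldescE tj; group_lia.
Qed.

(** By [compat_last], the last condition puts [v t] outside the cone type of [x^-1]; as a descent
    condition it passes to larger elements. *)
Definition boundary v t x : Prop :=
  [/\ len v < len (v * r_ t), compat v x & ldesc t (v^-1 * x)].


End WeakOrder.

(** * Boundary pairs of cone types *)

Section Boundaries.
Variables (W : groupType) (S : finType) (C : coxeterSystem W S).
Local Open Scope group_scope.
Local Notation r_ := (gen C).
Local Notation len := (len C).
Local Notation le := (weak_le C).
Local Notation ldesc := (ldesc C).
Local Notation compat := (compat C).
Local Notation joins := (joins C).
Local Notation boundary := (boundary C).
Implicit Types (x y z w v : W) (s t r : S).

Lemma boundary_last v t x : boundary v t x -> len (v * r_ t) = (len v).+1.
Proof. by case=> l _ _; have := lenM C v (r_ t); rewrite len_gen; group_lia. Qed.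

Lemma boundary_ncompat v t x : boundary v t x -> ~ compat (v * r_ t) x.
Proof.
by move=> vtx /(compat_last _ (boundary_last vtx)) []; case: vtx => _ _ ->.
Qed.

Lemma boundary_le v t x y : le x y -> compat v y -> boundary v t x ->
  boundary v t y.
Proof.
move=> xy vy [l vx tx]; split=> //; apply: ldesc_le tx; exact/le_compat.
Qed.

(** Cone types are closed under prefixes, so a reduced word of [v] has a first letter [t] that leads
    out of the cone type. *)
Lemma not_compat_split v x : ~ compat v x ->
  exists u t w, [/\ v = u * r_ t * w, len v = (len u + (len w).+1)%N
                  & boundary u t x].
Proof.
have [n] := ubnP (len v); elim: n v => // n IH v ln nvx.
have [e|/eqP v1] := eqVneq v 1; first by case: nvx; rewrite e; exact: compat1.
have [v' [t [ev lv]]] := last_letter C v1; rewrite {v v1}ev in lv nvx ln *.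
have [v'x|nv'x] := pselect (compat v' x).
  exists v', t, 1; rewrite mulg1 len1 addn1; split=> //; split=> //.
    by rewrite lv.
  by apply: contrapT => /negP tx; apply: nvx; apply/compat_last.
have [||u [s [w [ev' lv' ux]]]] := IH v' => //; first by group_lia.
exists u, s, (w * r_ t); split=> //; first by rewrite ev' !mulgA.
have := lenM C (u * r_ s) (w * r_ t); have := lenM C w (r_ t).
have := lenM C u (r_ s); rewrite !len_gen mulgA -ev'.
by group_lia.
Qed.

(* The element [h_(v,t)] of the introduction is [v (v^-1 \/ t)]. *)
Definition least_boundary v t h : Prop :=
  boundary v t h /\ forall x, boundary v t x -> le h x.

Lemma ex_least_boundary v t x : boundary v t x ->
  exists2 h, least_boundary v t h & le h x.
Proof.
(* Translation by [v^-1] turns the boundary condition into two lower bounds of [v^-1 y], whose join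
   can be taken. *)
have leP y : boundary v t y -> le v^-1 (v^-1 * y) /\ le (r_ t) (v^-1 * y).
  by case=> _ /compat_leV ? ?; split=> //; apply/le_gen.
move=> vtx; have [vx tx] := leP x vtx.
have [j [vj tj jle] jx] := ex_joins vx tx.
have vh : compat v (v * j) by apply/compat_leV; rewrite mulKg.
have lub y : boundary v t y -> le (v * j) y.
  move=> vty; have [vy ty] := leP y vty; case: (vty) => _ cvy _.
  by apply/(le_compat vh cvy); rewrite mulKg; exact: jle.
exists (v * j); last exact: lub.
split=> //; case: vtx => l _ _; split=> //.
by rewrite mulKg; apply/le_gen.
Qed.

Lemma least_boundary_uniq v t h h' :
  least_boundary v t h -> least_boundary v t h' -> h = h'.
Proof. by move=> [h1 h2] [h1' h2']; apply: le_antisym; auto. Qed.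

Lemma least_boundary1 t : least_boundary 1 t (r_ t).
Proof.
split; first split.
- by rewrite mul1g len1 len_gen.
- exact: compat1.
- by rewrite invg1 mul1g; apply/le_gen; exact: le_refl.
by move=> x [_ _]; rewrite invg1 mul1g => /le_gen.
Qed.

Lemma compat_genM r v x : ~~ ldesc r v ->
  compat (r_ r * v) x <-> ~~ ldesc r x /\ compat v (r_ r * x).
Proof.
by move=> rv; rewrite compatM ?compat_gen ?genV // ldescN // len_gen.
Qed.

Lemma boundary_genM r v t x : ~~ ldesc r v ->
    len (r_ r * v) < len (r_ r * v * r_ t) ->
  boundary (r_ r * v) t x <-> ~~ ldesc r x /\ boundary v t (r_ r * x).
Proof.
move=> rv l.
have lv : len v < len (v * r_ t).
  by have := lenM C (r_ r) (v * r_ t); have := ldescN rv;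
    rewrite mulgA len_gen; group_lia.
have e : (r_ r * v)^-1 * x = v^-1 * (r_ r * x) by rewrite invgM genV mulgA.
split=> [[_ /(compat_genM _ rv) [rx vx]]|[rx [_ vx tx]]].
  by rewrite e.
by split=> //; [exact/compat_genM|rewrite e].
Qed.

Lemma joins_ldesc r a k : joins (r_ r) a k -> ldesc r k.
Proof. by case=> /le_gen. Qed.

Lemma joins_id r a : ldesc r a -> joins (r_ r) a a.
Proof. by move=> /le_gen ra; split=> //; exact: le_refl. Qed.

(** The recursion on the first letter: [h_(r v,t) = r (r \/ h_(v,t))], since by [boundary_genM] the
    translates by [r] of the elements with boundary [(r v,t)] lie above [r] and [h_(v,t)]. *)
Lemma least_boundary_genM r v t h a : ~~ ldesc r v ->
  least_boundary (r_ r * v) t h -> least_boundary v t a ->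
  joins (r_ r) a (r_ r * h).
Proof.
move=> rv [bh hle] [ba ale].
have l : len (r_ r * v) < len (r_ r * v * r_ t) by case: bh.
have [rh brh] := (boundary_genM h rv l).1 bh.
have ah := ale _ brh.
have rrh : le (r_ r) (r_ r * h) by apply/le_gen; rewrite ldesc_mul.
have [j jj jh] := ex_joins rrh ah; have [_ aj _] := jj.
have bj : boundary v t j.
  by apply: boundary_le ba => //; case: brh => _ + _; exact: compat_le.
have rj := joins_ldesc jj.
have hj : le h (r_ r * j).
  by apply: hle; apply/boundary_genM => //; rewrite ldesc_mul genK rj.
suff -> : r_ r * h = j by [].
apply: (le_antisym _ jh); rewrite -[j](genK C r).
by apply: le_genMlr; rewrite // ldesc_mul rj.
Qed.

(* If [r] is not below [a], some right letter of the join can be dropped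
   without losing [a], hence [r] is lost; by exchange this deletion is the
   left multiplication by [r]. *)
Lemma joins_nldesc r a k : ~~ ldesc r a -> joins (r_ r) a k ->
  exists2 s, r_ r * k = k * r_ s & le (r_ r * k) k.
Proof.
move=> ra jk; have rk := joins_ldesc jk; case: jk => [_ ak kle].
have [|s sk aks] := lt_right_descent ak.
  by move=> e; rewrite e rk in ra.
have rks : ~~ ldesc r (k * r_ s).
  by apply/negP => /le_gen rks; have := le_len (kle _ rks aks); group_lia.
have := @ldesc_new _ _ C r s _ rks; rewrite mulgenK => /(_ rk) e.
have e' : r_ r * k = k * r_ s by rewrite -{1}e genK.
exists s => //; rewrite /weak_le e' invgM genV -mulgA mulVg mulg1 len_gen.
by group_lia.
Qed.

End Boundaries.

(** * Joins of least elements with a given boundary pair *)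

Section Generation.
Variables (W : groupType) (S : finType) (C : coxeterSystem W S).
Local Open Scope group_scope.
Local Notation r_ := (gen C).
Local Notation len := (len C).
Local Notation le := (weak_le C).
Local Notation ldesc := (ldesc C).
Local Notation compat := (compat C).
Local Notation joins := (joins C).
Local Notation boundary := (boundary C).
Local Notation least_boundary := (least_boundary C).
Implicit Types (x y z w v : W) (s t r : S).

Definition generator n h : Prop :=
  exists v t, len v <= n /\ least_boundary v t h.

(** Says that [a] is the join of the generators below it, [a] itself being an upper bound of
    them. *)
Definition generated n a : Prop :=
  forall x, (forall h, generator n h -> le h a -> le h x) -> le a x.

Lemma generator_generated n h : generator n h -> generated n h.
Proof. by move=> gh x; apply=> //; exact: le_refl. Qed.

Lemma generated_mono n m a : n <= m -> generated n a -> generated m a.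
Proof.
move=> nm ga x xub; apply: ga => h [v [t [lv vth]]].
by apply: xub; exists v, t; split=> //; apply: leq_trans nm.
Qed.

Lemma generator_gen n r : generator n (r_ r).
Proof. by exists 1, r; rewrite len1; split=> //; exact: least_boundary1. Qed.

Lemma generated_joins n a b j : joins a b j -> generated n a ->
  generated n b -> generated n j.
Proof.
move=> [aj bj jle] ga gb x xub; apply: jle.
  by apply: ga => h gh ha; apply: xub => //; apply: le_trans aj.
by apply: gb => h gh hb; apply: xub => //; apply: le_trans bj.
Qed.

Lemma le_joins_gen r a b j k : le a b -> joins (r_ r) a j ->
  joins (r_ r) b k -> le (r_ r * j) (r_ r * k).
Proof.
move=> ab jj jk; have [rj rk] := (joins_ldesc jj, joins_ldesc jk).
apply/le_genM; first by rewrite rj rk.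
case: jj jk => [_ _ jle] [rk' bk _]; apply: jle => //.
exact: le_trans bk.
Qed.

(** The operation sending [a] to [r (r \/ a)] commutes with joins: if [e] is the join of the images
    of the generators, then [r e] lies above [r] and these generators, hence above [k]. This reduces
    closure statements to single generators. *)
Lemma generated_op_sup n r a k x : generated n a -> joins (r_ r) a k ->
    (forall h k', generator n h -> le h a -> joins (r_ r) h k' ->
       le (r_ r * k') x) ->
  le (r_ r * k) x.
Proof.
move=> ga jk xub; have rk := joins_ldesc jk; have [rk' ak kle] := jk.
pose Y := [set y | exists h k',
  [/\ generator n h, le h a, joins (r_ r) h k' & y = r_ r * k']].
have [|e [eub ele] ek] := @ex_lub _ _ C Y (r_ r * k).
  by move=> _ [h [k' [gh ha jk' ->]]]; exact: (le_joins_gen ha jk' jk).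
have ex : le e x by apply: ele => _ [h [k' [gh ha jk' ->]]]; exact: (xub h).
have re : ~~ ldesc r e.
  by apply/negP => /(ldesc_le ek); rewrite ldesc_mul rk.
apply: le_trans ex; rewrite -[e](genK C r); apply/le_genM.
  by rewrite ldesc_mul re rk.
apply: kle; first by apply/le_gen; rewrite ldesc_mul.
apply: ga => h gh ha.
have [k' jk' k'k] := ex_joins rk' (le_trans ha ak).
have : le (r_ r * k') e by apply: eub; exists h, k'.
move=> /(le_genMlr re); rewrite genK; case: jk' => _ hk' _.
exact: le_trans.
Qed.

Definition closed_op n : Prop := forall r a k,
  generated n a -> joins (r_ r) a k -> generated n.+1 (r_ r * k).

(** For [a = h_(v,t)], by [least_boundary_genM], [r k] is [h_(r v,t)] when [r v] is longer than [v]
    and the latter exists. Its join with [r] then needs no level above [n]: this is the crucial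
    fact. *)
Definition closed_op2 n : Prop := forall r a k f,
  generated n a -> joins (r_ r) a k -> joins (r_ r) (r_ r * k) f ->
  generated n f.

Lemma compat_gen_r r v : compat v (r_ r) <-> ~~ ldesc r v.
Proof. by rewrite (compatC C) compat_gen. Qed.

(** In this degenerate case exchange gives [r v = v t]. It forces [h_(v,t)] below [r]. *)
Lemma boundary_gen_swap r v t : ~~ ldesc r v -> len v < len (v * r_ t) ->
  ~~ (len (r_ r * v) < len (r_ r * v * r_ t)) -> boundary v t (r_ r).
Proof.
move=> rv lvt nl.
have rvt : ldesc r (v * r_ t).
  apply/negPn/negP => /ldescN; rewrite mulgA; have := ldescN rv.
  by group_lia.
have e := ldesc_new rv rvt; split=> //; first exact/compat_gen_r.
have -> : v^-1 * r_ r = r_ t * v^-1.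
  by rewrite -{1}(genV C r) -invgM e invgM genV.
by rewrite ldesc_mul ldescV; group_lia.
Qed.

(** Lifts [g] along [w] one letter at a time by [closed_op], each letter costing one level. *)
Lemma generated_word N m w F g : (forall j, j < N -> closed_op j) ->
    m + len w <= N -> generated m g -> compat w F -> le g (w^-1 * F) ->
  exists E, [/\ generated (m + len w) E, le E F, compat w E & le g (w^-1 * E)].
Proof.
move=> op; have [n] := ubnP (len w); elim: n w F => // n IH w F lw lN gg wF gF.
have [w1|/eqP/(ex_ldesc C) [s sw]] := eqVneq w 1.
  exists g; rewrite w1 len1 addn0 invg1 mul1g; split=> //; last exact: le_refl.
    by move: gF; rewrite w1 invg1 mul1g.
  exact: compat1.
pose w1 := r_ s * w; have ew : w = r_ s * w1 by rewrite genK.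
have sw1 : ~~ ldesc s w1 by rewrite ldesc_mul sw.
have lw1 : len w = (len w1).+1 by rewrite ew ldescN.
have ewx x : w^-1 * x = w1^-1 * (r_ s * x) by rewrite ew invgM genV mulgA.
have [sF w1F] : ~~ ldesc s F /\ compat w1 (r_ s * F).
  by apply/compat_genM => //; rewrite -ew.
have [||||| E1 [gE1 E1F w1E1 gE1']] := IH w1 (r_ s * F) => //.
- by group_lia.
- by group_lia.
- by rewrite -ewx.
have sF' : ldesc s (r_ s * F) by rewrite ldesc_mul.
have [k jk kF] := ex_joins ((le_gen C s _).2 sF') E1F.
have sk := joins_ldesc jk.
have w1k : compat w1 k by exact: compat_le w1F.
exists (r_ s * k); split.
- by rewrite lw1 addnS; apply: op jk => //; group_lia.
- by rewrite -[F](genK C s); apply/le_genM => //; rewrite sk sF'.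
- by rewrite ew; apply/compat_genM => //; rewrite ldesc_mul sk genK.
- rewrite ewx genK; apply: le_trans gE1' _; apply/le_compat => //.
  by case: jk.
Qed.

Lemma closed_op_step n : (forall m, m < n -> closed_op m /\ closed_op2 m) ->
  closed_op n.
Proof.
move=> IH r a k ga jk x xub.
apply: (generated_op_sup ga jk) => h k' [v [t [lv vth]]] ha jk'.
have rk' := joins_ldesc jk'.
suff gk' : generated n.+1 (r_ r * k').
  apply: gk' => g gg gk'; apply: xub => //; apply: le_trans gk' _.
  exact: (le_joins_gen ha jk' jk).
case: (vth) => bh hle; case: (bh) => lvt vh th.
(* With [v = r v'] and [b = h_(v',t)], [h = r (r \/ b)]; so [k' = r \/ h] has level [len v'] by
   [closed_op2], and [r k' = r (r \/ k')] the next one. *)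
have [rv|rv] := boolP (ldesc r v).
  pose v' := r_ r * v; have ev : v = r_ r * v' by rewrite genK.
  have rv' : ~~ ldesc r v' by rewrite ldesc_mul rv.
  have lv' : len v = (len v').+1 by rewrite ev ldescN.
  rewrite ev in lvt bh vth.
  have [rh bb] := (boundary_genM h rv' lvt).1 bh.
  have [b vtb _] := ex_least_boundary bb.
  have jb := least_boundary_genM rv' vth vtb.
  have lt : len v' < n by group_lia.
  have [op op2] := IH _ lt.
  have gb : generated (len v') b.
    by apply: generator_generated; exists v', t.
  have gk' : generated (len v') k' by apply: op2 gb jb _; rewrite genK.
  apply: (@generated_mono (len v').+1); first by group_lia.
  by apply: op gk' _; exact: joins_id.
have [l|nl] := boolP (len (r_ r * v) < len (r_ r * v * r_ t)); last first.
  have hr := hle _ (boundary_gen_swap rv lvt nl).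
  case: jk' => rk1 _ k'le.
  have -> : k' = r_ r.
    by apply: le_antisym rk1; apply: k'le => //; exact: le_refl.
  by rewrite gen_sq => y _; exact: le1.
have [_ hk' _] := jk'.
(* The join with [r] keeps [v] in the cone type, so [h_(r v,t)] exists and equals [r k']. *)
have bk' : boundary v t k'.
  apply: boundary_le bh => //; apply: compat_joins jk' _ vh.
  exact/compat_gen_r.
have brk' : boundary (r_ r * v) t (r_ r * k').
  by apply/boundary_genM => //; rewrite ldesc_mul rk' genK.
have [h' vth' _] := ex_least_boundary brk'.
have -> : k' = r_ r * h'.
  exact: joins_uniq jk' (least_boundary_genM rv vth' vth).
rewrite genK; apply: generator_generated; exists (r_ r * v), t; split=> //.
by rewrite ldescN.
Qed.
End Generation.

(** * Gates *)

Section Gates.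
Variables (W : groupType) (S : finType) (C : coxeterSystem W S).
Local Open Scope group_scope.
Local Notation r_ := (gen C).
Local Notation len := (len C).
Local Notation le := (weak_le C).
Local Notation ldesc := (ldesc C).
Local Notation compat := (compat C).
Local Notation joins := (joins C).
Local Notation boundary := (boundary C).
Local Notation least_boundary := (least_boundary C).
Local Notation generator := (generator C).
Local Notation generated := (generated C).
Local Notation closed_op := (closed_op C).
Local Notation closed_op2 := (closed_op2 C).
Implicit Types (x y z w v : W) (s t r : S).

(* The hard case is [r] below [a = h_(v,t)]. Then [h = r a] is [h_(r v,t)],
   [f = r \/ h], and [F = r f] is [f] with a right letter removed, so that
   [v] cannot lie in the cone type of [f^-1]: otherwise [a] would be below [F].
   Splitting [v = u q v3] where it leaves this cone type, and with [w = r u], one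
   finds [E] between [h] and [F], generated at level [len v], by lifting along
   [w] the join [q \/ q (q \/ h_(v3,t))]. *)
Lemma closed_op2_generator n r v t a k f :
    (forall m, m < n -> closed_op m /\ closed_op2 m) ->
    len v <= n -> least_boundary v t a -> joins (r_ r) a k ->
    joins (r_ r) (r_ r * k) f ->
  generated n f.
Proof.
move=> IH lv vta jk jf; have rk := joins_ldesc jk; have rf := joins_ldesc jf.
have gr : generated n (r_ r) by apply/generator_generated/generator_gen.
have [rf' rkf fle] := jf.
(* If [r] is not below [a], then [r k] lies below [k], so [f = k = r \/ a]. *)
have [ra|ra] := boolP (ldesc r a); last first.
  have [s _ rkk] := joins_nldesc ra jk; have [rk' ak kle] := jk.
  have -> : f = k.
    apply: (@le_antisym _ _ C); first exact: fle.
    by rewrite -[k](genK C r); apply: le_genMl; rewrite // ldesc_mul rk.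
  apply: generated_joins jk gr _; apply: generator_generated.
  by exists v, t.
have ek : k = a := joins_uniq jk (joins_id ra).
rewrite {k}ek in jk rk jf rkf fle.
set h := r_ r * a in jf rkf fle.
have ea : a = r_ r * h by rewrite genK.
have rh : ~~ ldesc r h by rewrite ldesc_mul ra.
have [s eF Ff] := joins_nldesc rh jf; set F := r_ r * f in eF Ff.
have efF : f = r_ r * F by rewrite genK.
have rF : ~~ ldesc r F by rewrite ldesc_mul rf.
have hF : le h F by exact: le_genMr.
have af : le a f by rewrite ea; exact: le_genMl.
have [bva ale] := vta; have [lvt va ta] := bva.
have rv : ~~ ldesc r v.
  by apply/(compat_gen_r C); apply: compat_le va; apply/le_gen.
have [l|nl] := boolP (len (r_ r * v) < len (r_ r * v * r_ t)); last first.
  have ar := ale _ (boundary_gen_swap rv lvt nl).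
  have ear : a = r_ r by apply: (le_antisym ar); apply/le_gen.
  have -> : f = r_ r.
    apply: (le_antisym _ rf'); apply: fle; first exact: le_refl.
    by rewrite /h ear gen_sq; exact: le1.
  exact: gr.
have ncf : ~ compat v f.
  move=> vf; have vF := compat_le Ff vf.
  have [_ _ tf] := boundary_le af vf bva.
  have [tF|tF] := boolP (ldesc t (v^-1 * F)).
    have /ale aF : boundary v t F by [].
    by have := ldesc_le aF ra; rewrite (negbTE rF).
  (* Now exchange gives [t v^-1 F = v^-1 f], hence [r v t = v], contradicting that [r v t] is longer
     than [r v]. *)
  have := @ldesc_new _ _ C t s _ tF.
  rewrite -mulgA eF mulgenK => /(_ tf) e.
  have e2 : r_ t * v^-1 * r_ r = v^-1.
    by apply: (mulIg f); rewrite -[RHS]e -eF /F !mulgA.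
  have e3 : r_ r * v * r_ t = v.
    by rewrite -[RHS]invgK -e2 !invgM invgK !genV mulgA.
  by move: l; rewrite e3 ldescN // ltnNge leqW.
have [u [q [v3 [ev luv uqf]]]] := not_compat_split ncf.
have [_ uf qf] := uqf.
have uv : le u v.
  rewrite /weak_le {2}ev -!mulgA mulKg luv.
  have := lenM C u (r_ q * v3); have := lenM C (r_ q) v3.
  by rewrite [u * _]mulgA -ev len_gen; group_lia.
have lqv : len (r_ q * v3) = (len v3).+1.
  have := lenM C u (r_ q * v3); have := lenM C (r_ q) v3.
  by rewrite [u * _]mulgA -ev len_gen; group_lia.
have qv3 : ~~ ldesc q v3 by rewrite -leqNgt lqv; group_lia.
have ru : ~~ ldesc r u by apply: contra rv; exact: ldesc_le.
pose w := r_ r * u; have lw : len w = (len u).+1 by rewrite /w ldescN.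
have ewx x : w^-1 * x = u^-1 * (r_ r * x) by rewrite invgM genV mulgA.
have wF : compat w F by apply/compat_genM => //; rewrite -efF.
have erv : r_ r * v = w * (r_ q * v3) by rewrite ev !mulgA.
have brh : boundary (r_ r * v) t h by apply/boundary_genM => //; rewrite -ea.
have lrv : len (w * (r_ q * v3)) = (len w + len (r_ q * v3))%N.
  by rewrite -erv ldescN // lw lqv luv addSn.
have [_ rvh trvh] := brh.
have [wh /(compat_genM _ qv3) [qH v3H]] :
    compat w h /\ compat (r_ q * v3) (w^-1 * h).
  by apply/compatM => //; rewrite -erv.
set H := w^-1 * h in qH v3H.
have erx x : (r_ r * v)^-1 * x = v3^-1 * (r_ q * (w^-1 * x)).
  by rewrite erv !invgM genV !mulgA.
have bv3 : boundary v3 t (r_ q * H).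
  split=> //; last by rewrite -erx.
  have ervt : r_ r * v * r_ t = w * (r_ q * (v3 * r_ t)) by rewrite erv !mulgA.
  move: l; rewrite ervt erv; have := lenM C w (r_ q * (v3 * r_ t)).
  by have := lenM C (r_ q) (v3 * r_ t); rewrite lrv lqv len_gen; clear; group_lia.
have [b v3b bH] := ex_least_boundary bv3.
have qH' : le (r_ q) (r_ q * H) by apply/le_gen; rewrite ldesc_mul.
have [k1 jk1 k1H] := ex_joins qH' bH; have qk1 := joins_ldesc jk1.
pose d := r_ q * k1.
have dH : le d H.
  by rewrite -[H](genK C q); apply/le_genM => //; rewrite qk1 ldesc_mul.
have HZ : le H (w^-1 * F) by apply/le_compat.
have qZ : le (r_ q) (w^-1 * F) by apply/le_gen; rewrite ewx -efF.
have [g jg gZ] := ex_joins qZ (le_trans dH HZ).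
(* The letter [r] of [w = r u] makes up for the letter [q] of [v], so the lift ends exactly at level
   [len v]. *)
have lvw : (len v3 + len w)%N = len v by rewrite lw luv addnC addSnnS.
have lt : len v3 < n by apply: leq_trans lv; rewrite luv addnS ltnS leq_addl.
have gg : generated (len v3) g.
  have [_ op2] := IH _ lt; apply: op2 jk1 jg.
  by apply: generator_generated; exists v3, t.
have opn j : j < n -> closed_op j by move=> /IH [].
have [|E [gE EF wE gE']] := generated_word opn _ gg wF gZ.
  by rewrite lvw.
(* The element [w (w^-1 \/ d)] is below [h] and [E] and has boundary [(r v,t)], for which [h] is
   least. *)
have hE : le h E.
  have [_ dg _] := jg.
  have dE := le_trans dg gE'.
  have wE' := (compat_leV C _ _).1 wE; have wh' := (compat_leV C _ _).1 wh.
  have [d0 jd0 d0E] := ex_joins wE' dE; have [wd0 dd0 d0le] := jd0.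
  have d0H : le d0 H by apply: d0le.
  pose h' := w * d0; have eh' : w^-1 * h' = d0 by rewrite mulKg.
  have wch' : compat w h' by apply/compat_leV; rewrite eh'.
  have h'h : le h' h by apply/(le_compat wch' wh); rewrite eh'.
  have h'E : le h' E by apply/(le_compat wch' wE); rewrite eh'.
  have qd0 : ~~ ldesc q d0 by apply: contra qH; exact: ldesc_le.
  have v3d0 : compat v3 (r_ q * d0) by apply: compat_le v3H; exact: le_genMlr.
  have bd0 : le b (r_ q * d0).
    have [_ bk1 _] := jk1; apply: le_trans bk1 _.
    by rewrite -[k1](genK C q); exact: le_genMlr.
  have bh' : boundary (r_ r * v) t h'.
    split=> //; first exact: compat_le h'h rvh.
    by rewrite erx eh'; case: (boundary_le bd0 v3d0 v3b.1).
  have [hh [bhh hhle] _] := ex_least_boundary brh.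
  have ehh : r_ r * hh = a.
    by apply: joins_uniq (joins_id ra); exact: least_boundary_genM vta.
  have <- : hh = h by rewrite /h -ehh genK.
  exact: le_trans (hhle _ bh') h'E.
move=> x xub; apply: fle; first by apply: xub => //; exact: generator_gen.
apply: le_trans hE _; apply: (@generated_mono _ _ C _ n _ _ gE).
  by rewrite lvw.
move=> y gy yE; apply: xub => //; apply: le_trans yE _.
exact: le_trans Ff.
Qed.

Lemma closed_op2_step n : (forall m, m < n -> closed_op m /\ closed_op2 m) ->
  closed_op2 n.
Proof.
move=> IH r a k f ga jk jf x xub; have [rf rkf fle] := jf.
apply: fle; first by apply: xub => //; exact: generator_gen.
apply: (generated_op_sup ga jk) => h k' [v [t [lv vth]]] ha jk'.
have rk'f := le_trans (le_joins_gen ha jk' jk) rkf.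
have [f' jf' f'f] := ex_joins rf rk'f.
have gf' := closed_op2_generator IH lv vth jk' jf'.
have : le f' x.
  by apply: gf' => g gg gf'; apply: xub => //; apply: le_trans f'f.
by case: jf' => _ + _; exact: le_trans.
Qed.

Lemma generated_op2 n : closed_op2 n.
Proof.
suff : closed_op n /\ closed_op2 n by case.
have [m] := ubnP n; elim: m n => // m IH n nm.
have IH' i : i < n -> closed_op i /\ closed_op2 i.
  by move=> lt; apply: IH; group_lia.
by split; [exact: closed_op_step|exact: closed_op2_step].
Qed.

(** By [compat_le] the hypotheses make the cone types of [y^-1] and [z^-1] equal; in the application
    [y] is the gate of [z]. *)
Lemma generator_le n h y z : generator n h -> le y z ->
  (forall v, compat v y -> compat v z) -> le h z -> le h y.
Proof.
have descent t y' z' : (forall v, compat v y' -> compat v z') ->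
    ldesc t z' -> ldesc t y'.
  move=> yz; apply: contraLR => /compat_gen/yz; exact: (compat_gen C _ _).1.
elim: n h y z => [|n IH] h y z [v [t [lv vth]]] yz yzc hz.
  have v1 : v = 1 by apply: (@len_eq0 _ _ C); group_lia.
  rewrite v1 in vth; rewrite (least_boundary_uniq vth (least_boundary1 C t)) in hz *.
  by apply/le_gen; apply: descent yzc _; apply/le_gen.
have [v1|/eqP/(ex_ldesc C) [r rv]] := eqVneq v 1.
  rewrite v1 in vth; rewrite (least_boundary_uniq vth (least_boundary1 C t)) in hz *.
  by apply/le_gen; apply: descent yzc _; apply/le_gen.
pose v' := r_ r * v; have ev : v = r_ r * v' by rewrite genK.
have rv' : ~~ ldesc r v' by rewrite ldesc_mul rv.
have lv' : len v = (len v').+1 by rewrite ev ldescN.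
rewrite ev in vth; have [bh _] := vth; have [lvt _ _] := bh.
have [rh bb] := (boundary_genM h rv' lvt).1 bh.
have [b vtb _] := ex_least_boundary bb.
have gb : generator n b by exists v', t; split=> //; group_lia.
have jb := least_boundary_genM rv' vth vtb; have [_ bh' jble] := jb.
have [rz|rz] := boolP (ldesc r z).
  have ry := descent _ _ _ yzc rz.
  have [f jf fz] := ex_joins ((le_gen C _ _).2 rz) hz; have [_ hf _] := jf.
  have gf : generated n f.
    by apply: (generated_op2 (generator_generated gb) jb); rewrite genK.
  apply: le_trans hf _; apply: gf => g gg gf.
  by apply: (IH g y z) => //; apply: le_trans fz.
(* Cancelling [r] preserves the relation between [y] and [z], so [b] is below [r y], and so is
   [r h = r \/ b]. *)
have ry : ~~ ldesc r y by apply: contra rz; exact: ldesc_le.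
have ryy : ldesc r (r_ r * y) by rewrite ldesc_mul.
have byr : le b (r_ r * y).
  apply: (IH b _ (r_ r * z)) => //; first exact: le_genMlr.
    move=> w wy; have rw : ~~ ldesc r w.
      by apply/(compat_gen_r C); apply: compat_le wy; apply/le_gen.
    apply: (proj2 ((compat_genM z rw).1 (yzc _ _))).
    exact/compat_genM.
  apply: le_trans bh' _; exact: le_genMlr.
apply/(@le_genM _ _ C r); first by rewrite (negbTE rh) (negbTE ry).
by apply: jble => //; apply/le_gen.
Qed.

Lemma cone_type_compat x v : cone_type C x^-1 v <-> compat v x.
Proof. rewrite (compatC C v x) /cone_type /= lenV; exact: iff_refl. Qed.

Lemma cone_type_eq x y : cone_type C x^-1 = cone_type C y^-1 <->
  forall v, compat v x <-> compat v y.
Proof.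
split=> [e v|e]; first by rewrite -!cone_type_compat e.
by apply/seteqP; split=> v /cone_type_compat vx; apply/cone_type_compat/e.
Qed.

Lemma gatesP g :
  gates C g <-> forall x, (forall v, compat v x <-> compat v g) -> le g x.
Proof.
split=> [[_ [w _ <-] [gT gle]] x xg|gle].
  by apply: gle; rewrite /cone_part /= -gT; apply/cone_type_eq.
exists (cone_type C g^-1); first by exists g^-1.
by split=> // x /cone_type_eq; exact: gle.
Qed.

Lemma gates1 : gates C 1.
Proof. by apply/gatesP => x _; exact: le1. Qed.

Lemma boundary_same v t x y : (forall w, compat w x <-> compat w y) ->
  boundary v t x -> boundary v t y.
Proof.
move=> xy vtx; have [l vx _] := vtx; have vy := (xy v).1 vx.
split=> //; apply: contrapT => /negP ty; apply: (boundary_ncompat vtx).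
by apply/xy/compat_last => //; exact: boundary_last vtx.
Qed.

Lemma boundary_not_compat u t w x : boundary u t x ->
  len (u * r_ t * w) = (len u + (len w).+1)%N -> ~ compat (u * r_ t * w) x.
Proof.
move=> utx l; rewrite compatM ?(boundary_last utx) ?l ?addSnnS // => -[].
by move=> /(boundary_ncompat utx).
Qed.

(** Take the join of [h_(v,t)] over the boundary pairs of [z]. An element outside the cone type of
    [z^-1] leaves it at such a pair, which is also one of [g], so the cone types agree. *)
Lemma ex_gate z : exists g,
  [/\ gates C g, le g z, (forall v, compat v g -> compat v z) &
   forall y, (forall v t h, least_boundary v t h -> le h g -> le h y) -> le g y].
Proof.
pose X := [set h | exists v t, least_boundary v t h /\ boundary v t z].
have [|g [gub gle] gz] := @ex_lub _ _ C X z.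
  by move=> h [v [t [[_ hle] vtz]]]; exact: hle.
have gc v : compat v g -> compat v z.
  move=> vg; apply: contrapT => /not_compat_split [u [q [w [ev lv uqz]]]].
  have [h uqh hz] := ex_least_boundary uqz; have [_ uz _] := uqz.
  have hg : le h g by apply: gub; exists u, q.
  have uqg := boundary_le hg (compat_le gz uz) uqh.1.
  by rewrite ev in vg lv; exact: (boundary_not_compat uqg lv).
exists g; split=> //.
  apply/gatesP => x xg; apply: gle => h [v [t [[_ hle] vtz]]].
  apply: hle; apply: boundary_same vtz => w; rewrite xg.
  by split; [exact: compat_le|exact: gc].
move=> y yub; apply: gle => h [v [t [vth vtz]]].
by apply: (yub v t) => //; apply: gub; exists v, t.
Qed.

(** The gate produced by [ex_gate] for [a] is [a] itself, hence [a] is a join of elements [h_(v,t)],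
    to which [generator_le] applies. *)
Lemma le_gate a z g : gates C a -> le a z -> le g z ->
  (forall v, compat v g -> compat v z) -> le a g.
Proof.
move=> ga az gz gc; have [a' [_ a'a ac ale]] := ex_gate a.
have ea : a = a'.
  apply/esym/(le_antisym a'a); apply: (gatesP a).1 ga _ _ => v.
  by split; [exact: ac|exact: compat_le].
rewrite ea; apply: ale => v t h vth ha.
apply: (@generator_le (len v) _ _ z) => //; first by exists v, t.
exact: le_trans ha (le_trans a'a az).
Qed.

Lemma le_right_descent x s : (len (x * r_ s)).+1 = len x -> le (x * r_ s) x.
Proof.
by move=> l; rewrite /weak_le invgM genV -mulgA mulVg mulg1 len_gen -l addn1.
Qed.

(* A gate [g] loses its cone type when the descent [r] is deleted; a minimal
   element below [y] but not below [g r] inherits this property. *)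
Lemma ex_gate_not_le g r y : gates C g -> (len (g * r_ r)).+1 = len g ->
    le y g -> ~ le y (g * r_ r) ->
  exists x, [/\ gates C x, le x y & ~ le x (g * r_ r)].
Proof.
move=> gg gr yg nygr; have grg := le_right_descent gr.
have ex_x : exists n, `[< exists x, [/\ le x y, ~ le x (g * r_ r) & len x = n] >].
  by exists (len y); apply/asboolP; exists y; split=> //; exact: le_refl.
case: (ex_minnP ex_x) => n /asboolP [x [xy nxgr lx]] n_min.
exists x; split=> //; have [x' [gx' x'x xc _]] := ex_gate x.
suff <- : x' = x by [].
apply: contrapT => /(lt_right_descent x'x) [s xs x'xs].
have xsx := le_right_descent xs.
(* By minimality of [x], everything strictly below it is below [g r]. *)
have x'gr : le x' (g * r_ r).
  apply: le_trans x'xs _; apply: contrapT => nxs.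
  suff : n <= len (x * r_ s) by group_lia.
  by apply: n_min; apply/asboolP; exists (x * r_ s); split=> //; exact: le_trans xy.
have [v [vgr nvg]] : exists v, compat v (g * r_ r) /\ ~ compat v g.
  apply: contrapT => H.
  suff /le_len : le g (g * r_ r) by group_lia.
  apply: (gatesP g).1 gg _ _ => v; split; last exact: compat_le.
  by move=> vgr; apply: contrapT => nvg; apply: H; exists v.
have [u [q [w [ev lv uqg]]]] := not_compat_split nvg.
have [_ ug qg] := uqg; have luq := boundary_last uqg.
have uqgr : compat (u * r_ q) (g * r_ r).
  by move: vgr; rewrite ev compatM -?ev ?lv ?luq ?addSnnS // => -[].
have [ugr qgr] := (compat_last _ luq).1 uqgr.
have [ux qx] := (compat_last _ luq).1 (xc _ (compat_le x'gr uqgr)).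
(* Deleting [r] is cancelling [q] after translation by [u^-1]. As [q] is not a left descent of
   [u^-1 x], [x] stays below [g r]. *)
have e : r_ q * (u^-1 * (g * r_ r)) = u^-1 * g.
  by rewrite (@ldesc_new _ _ C q r) // -mulgA mulgenK.
apply: nxgr; apply/(le_compat ux ugr).
have -> : u^-1 * (g * r_ r) = r_ q * (u^-1 * g) by rewrite -e genK.
by apply: le_genMr => //; apply/le_compat => //; exact: le_trans yg.
Qed.

Lemma gates_join_irreducibleP g :
  join_irreducible le (gates C) g <->
  gates C g /\ exists s, right_descents C g = [set s].
Proof.
split=> [[gg gmin girr]|[gg [s gs]]]; last first.
  have sg : (len (g * r_ s)).+1 = len g.
    by have : right_descents C g s by rewrite gs.
  split=> //.
    move=> [_ /(_ _ gates1) /le_len]; rewrite len1; group_lia.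
  move=> a b ga gb [_ ag bg gle]; apply: contrapT => /not_orP [nag nbg].
  have le_gs x : le x g -> g <> x -> le x (g * r_ s).
    move=> xg /nesym/(lt_right_descent xg) [t tg xgt].
    by have : right_descents C g t by []; rewrite gs => <-.
  (* The gate [z] bounds [a] and [b], so [g] would lie below [g s]. *)
  have [z [gz zgs zc _]] := ex_gate (g * r_ s).
  have lez x : gates C x -> le x g -> g <> x -> le x z.
    by move=> gx xg ngx; apply: le_gate (le_gs x xg ngx) zgs zc.
  have gz' : le g z by apply: gle => //; exact: lez.
  by have := le_len (le_trans gz' zgs); group_lia.
split=> //; have g1 : 1 <> g.
  by move=> e; apply: gmin; split=> // y _; rewrite -e; exact: le1.
have [s sg _] := lt_right_descent (le1 C g) g1.
exists s; apply/seteqP; split=> [r rg0|_ -> //]; apply: contrapT => nrs.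
have rg : (len (g * r_ r)).+1 = len g := rg0.
have [a [ga ags ac _]] := ex_gate (g * r_ s).
have [b [gb bgr bc _]] := ex_gate (g * r_ r).
have ag := le_trans ags (le_right_descent sg).
have bg := le_trans bgr (le_right_descent rg).
have [j jj jg] := ex_joins ag bg; have [aj bj jle] := jj.
(* The gate of [j] already bounds [a] and [b] by [le_gate]. *)
have gj : gates C j.
  have [j' [gj' j'j jc _]] := ex_gate j.
  suff -> : j = j' by [].
  by apply: (le_antisym _ j'j); apply: jle; apply: le_gate j'j jc.
(* Otherwise every gate below [g t] would be below [c], hence below [j] and [g q], contradicting
   [ex_gate_not_le]. *)
have no_descent q t c : (len (g * r_ q)).+1 = len g ->
    (len (g * r_ t)).+1 = len g -> q <> t -> le c (g * r_ t) ->
    (forall v, compat v c -> compat v (g * r_ t)) -> le c j ->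
    ~ le j (g * r_ q).
  move=> qg tg qt cgt cc cj jgq.
  have [|x [gx xgt nxgq]] := ex_gate_not_le gg qg (le_right_descent tg).
    move=> /le_len_eq e; apply: qt; apply: (@gen_inj _ _ C); apply: (mulgI g).
    by rewrite e //; group_lia.
  apply: nxgq; apply: le_trans jgq; apply: le_trans cj.
  exact: le_gate cgt cc.
have [ej|nej] := pselect (j = g).
  case: (girr a b ga gb); first by split=> // z _; rewrite -ej; exact: jle.
    by move=> e; move: (le_len ags); rewrite -e; group_lia.
  by move=> e; move: (le_len bgr); rewrite -e; group_lia.
(* If [j] is not [g], it lies below some [g q]; at least one of [r] and [s] differs from [q] and
   serves as [t]. *)
have [q qg jgq] := lt_right_descent jg nej.
have [qr|nqr] := pselect (q = r).
  by apply: (no_descent q s a) => //; rewrite qr.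
exact: (no_descent q r b).
Qed.

End Gates.

(** * Counting right-descent roots *)

Section Roots.
Variables (R : realType) (W : groupType) (S : finType) (C : coxeterSystem W S).

Lemma act_inj w : injective (act (R := R) C w).
Proof. by apply: (can_inj (g := act C w^-1%g)) => v; rewrite -actM mulVg act1. Qed.

Lemma simple_root_inj : injective (@simple_root R S).
Proof.
move=> s t e; apply/eqP; have := simple_rootE R t s.
by rewrite -e simple_rootE eqxx; case: eqP => // _ /eqP; rewrite GRing.oner_eq0.
Qed.

Lemma card_eq_I1P T (A : set T) : A #= `I_1 <-> exists x, A = [set x].
Proof.
split=> [/card_set_bijP [f [fA finj fsurj]]|[x ->]]; last exact: card_set1.
have [x Ax _] : (f @` A) 0 by apply: fsurj.
exists x; apply/seteqP; split=> [y Ay|_ -> //]; apply: finj; rewrite ?inE //.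
by have := fA _ Ax; have := fA _ Ay; rewrite /=; lia.
Qed.

(** Distinct descents give distinct roots, because [w] acts injectively. *)
Lemma right_descent_roots_card w :
  right_descent_roots R C w #= `I_1 <-> exists s, right_descents C w = [set s].
Proof.
rewrite -card_eq_I1P; have e : right_descent_roots R C w #= right_descents C w.
  apply: inj_card_eq => s t _ _ /GRing.oppr_inj/act_inj; exact: simple_root_inj.
by split; apply: card_eq_trans; rewrite // card_eq_sym.
Qed.
End Roots.

Theorem theorem2 (R : realType) (W : groupType) (S : finType)
    (C : coxeterSystem W S) :
  [set g | gates C g /\ right_descent_roots R C g #= `I_1]
  = [set g | join_irreducible (weak_le C) (gates C) g].
Proof.
apply/seteqP; split=> g /=.
  by move=> [gg /right_descent_roots_card gs]; apply/gates_join_irreducibleP.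
move=> /gates_join_irreducibleP [gg gs].
by split=> //; apply/right_descent_roots_card.
Qed.
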